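(* Let $b\ge2$ be a fixed integer and let $\pi_b(n)$ denote the number of prime polynomials of degree $n-1$ in $\mathcal B_b[x]$. Then $\pi_b(n)\sim(b-1)^2b^{n-2}$ as $n\to\infty$, i.e. $$\lim_{n\to\infty}\frac{\pi_b(n)}{(b-1)^2b^{n-2}}=1 .$$
   Context: $\mathcal B_b=\{0,1,\dots,b-1\}$ is the semiring with operations $a\oplus c=\max(a,c)$ and $a\otimes c=\min(a,c)$ (zero element $0$, multiplicative identity $b-1$). Polynomials in $\mathcal B_b[x]$ are added coefficientwise with $\oplus$ and multiplied by convolution: if $f=\bigoplus_k\alpha_kx^k$ and $g=\bigoplus_k\beta_kx^k$, the coefficient of $x^n$ in $f\otimes g$ is $\max_{0\le k\le n}\min(\alpha_k,\beta_{n-k})$. The degree of a polynomial is the largest index of a nonzero coefficient. A polynomial $h\in\mathcal B_b[x]$ is prime if $h=f\otimes g$ (with $f,g\in\mathcal B_b[x]$) implies that $f$ or $g$ equals the constant polynomial $b-1$. *)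

(* Defs.v *)
From HB Require Import structures.
From mathcomp Require Export all_boot all_order all_algebra finmap.
From mathcomp Require Export all_classical all_reals all_analysis.
Set Implicit Arguments. Unset Strict Implicit. Unset Printing Implicit Defensive.
Import Order.TTheory GRing.Theory Num.Theory.
Export numFieldNormedType.Exports.
Local Open Scope ring_scope.

(* The carrier is literally 'I_b; the phantom argument hb only serves to make
   the semiring structure (which needs 0 and b - 1 to exist and be distinct)
   inferrable, and to keep it apart from the modular structures of 'I_n.+1. *)
Definition maxmin (b : nat) (hb : (2 <= b)%N) : Type := 'I_b.

Section MaxMin.
Variables (b : nat) (hb : (2 <= b)%N).
Notation B := (maxmin hb).

HB.instance Definition _ := Choice.copy B 'I_b.
HB.instance Definition _ := Finite.copy B 'I_b.

Fact maxmin_zero_subproof : (0 < b)%N. Proof. exact: ltnW. Qed.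
Fact maxmin_one_subproof : (b.-1 < b)%N. Proof. by rewrite ltn_predL ltnW. Qed.

Definition maxmin_zero : B := Ordinal maxmin_zero_subproof.
Definition maxmin_one : B := Ordinal maxmin_one_subproof.
Definition maxmin_add (x y : B) : B := Order.max (x : 'I_b) (y : 'I_b).
Definition maxmin_mul (x y : B) : B := Order.min (x : 'I_b) (y : 'I_b).

Fact maxmin_addA : associative maxmin_add.
Proof. exact: maxA. Qed.
Fact maxmin_addC : commutative maxmin_add.
Proof. exact: maxC. Qed.
Fact maxmin_add0r : left_id maxmin_zero maxmin_add.
Proof. by move=> x; apply: max_r; rewrite leEord. Qed.

HB.instance Definition _ :=
  GRing.isNmodule.Build B maxmin_addA maxmin_addC maxmin_add0r.

Fact maxmin_mulA : associative maxmin_mul.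
Proof. exact: minA. Qed.
Fact maxmin_mulC : commutative maxmin_mul.
Proof. exact: minC. Qed.
Fact maxmin_mul1r : left_id maxmin_one maxmin_mul.
Proof.
by move=> x; apply: min_r; rewrite leEord /= -ltnS prednK ?ltn_ord // ltnW.
Qed.
Fact maxmin_mulDl : left_distributive maxmin_mul maxmin_add.
Proof. by move=> x y z; apply: min_maxl. Qed.
Fact maxmin_mul0r : left_zero maxmin_zero maxmin_mul.
Proof. by move=> x; apply: min_l; rewrite leEord. Qed.
Fact maxmin_oner_neq0 : maxmin_one != maxmin_zero.
Proof. by rewrite -val_eqE /= -lt0n -ltnS prednK // ltnW. Qed.

HB.instance Definition _ := GRing.Nmodule_isComNzSemiRing.Build B
  maxmin_mulA maxmin_mulC maxmin_mul1r maxmin_mulDl maxmin_mul0r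
  maxmin_oner_neq0.

(* [1 : {poly B}] is the constant polynomial b - 1; by this definition it is
   itself prime, which affects only degree 0. *)
Definition prime_maxmin (h : {poly B}) : Prop :=
  forall f g : {poly B}, h = f * g -> f = 1 \/ g = 1.

(* [size h = n] says that h has degree n - 1, for n >= 1.  [fset_set] of an
   infinite set is empty; see [finite_prime_maxmin]. *)
Definition prime_maxmin_of_size (n : nat) : set {poly B} :=
  [set h : {poly B} | size h = n /\ prime_maxmin h]%classic.

Definition prime_maxmin_count (n : nat) : nat :=
  #|` fset_set (prime_maxmin_of_size n)|%fset.

Lemma finite_prime_maxmin n : finite_set (prime_maxmin_of_size n).
Proof.
apply: (@sub_finite_set _ _ [set Poly (val t) | t in [set: n.-tuple B]]%classic).
  move=> h [/eqP sh _]; exists (Tuple sh) => //=; exact: polyseqK.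
exact/finite_image/finite_finset.
Qed.

Lemma maxmin_coefM (f g : {poly B}) n :
  nat_of_ord (f * g)`_n =
  (\max_(k < n.+1) minn (nat_of_ord (f`_k)%R) (nat_of_ord (g`_(n - k))%R))%N.
Proof.
rewrite coefM; elim/big_ind2: _ => // [x u y v <- <-|i _].
- rewrite /GRing.add /= /maxmin_add /Order.max ltEord /maxn.
  by case: ifP.
- by rewrite /GRing.mul /= /maxmin_mul /Order.min ltEord /minn; case: ifP.
Qed.

End MaxMin.

(* Main.v *)
(* In degree at least 2 a prime polynomial has a nonzero constant term, since
   otherwise x is a factor; the words of N + 1 coefficients with nonzero ends have
   density (1 - 1/b)^2.  It remains to see that, among all such words, the
   products h = f * g with f, g <> 1 have density tending to 0.

   If f or g is constant, no coefficient of h is b - 1.  If deg f = k lies in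
   [1, 2K], cut h into about N / (2k) windows of length 2k + 1: whenever the
   central coefficient of a window is nonzero, the support of h contains there a translate
   of the support F of f through its centre.  A random window satisfies this with
   probability at most rho < 1, uniformly in k and F, and there are only 2^(k+1)
   supports, so this case has density about 4^K rho^(N / 4K).  If both degrees
   exceed 2K, then for most pairs (f, g) the coefficients K, ..., 2K - 1 of
   f * g are all equal to b - 1, because each of them is the maximum of at least
   K independent minima; having such a block is a rare property of h, and the
   exceptional pairs have density O(N K (1 - b^-2)^K).  With K ~ N^(1/3) all
   contributions tend to 0. *)
Require Import Defs.
From mathcomp Require Import zify ring lra.
Import Order.TTheory GRing.Theory Num.Theory.
Set Implicit Arguments. Unset Strict Implicit. Unset Printing Implicit Defensive.
Local Open Scope ring_scope.

(** * Densities in finite types: union bounds and independence *)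

Section Density.
Variable R : realFieldType.
Implicit Types T I J L : finType.

Definition density T (P : pred T) : R := #|P|%:R / #|T|%:R.

Lemma density_ge0 T (P : pred T) : 0 <= density P.
Proof. by rewrite divr_ge0. Qed.

Lemma le_density T (P Q : pred T) : (forall x, P x -> Q x) -> density P <= density Q.
Proof.
move=> PQ; rewrite ler_wpM2r ?invr_ge0 // ler_nat.
by apply/subset_leq_card/fintype.subsetP.
Qed.

Lemma densityU_le T (P Q : pred T) :
  density (fun x => P x || Q x) <= density P + density Q.
Proof.
rewrite -mulrDl ler_wpM2r ?invr_ge0 // -natrD ler_nat.
by rewrite -(cardUI P Q) leq_addr.
Qed.

Lemma density_exists_le T I (D : pred I) (P : I -> pred T) :
  density (fun x => [exists i in D, P i x]) <= \sum_(i in D) density (P i).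
Proof.
rewrite -mulr_suml ler_wpM2r ?invr_ge0 // -natr_sum ler_nat.
under eq_bigr => i _ do rewrite -sum1_card.
rewrite -sum1_card (exchange_big_dep predT) //= [leqLHS]big_mkcond /=.
apply: leq_sum => x _; rewrite unfold_in; case: ifP => // /existsP[i /andP[Di Pi]].
by rewrite (bigD1 i) //= Di.
Qed.

Lemma densityC T (P : pred T) : (0 < #|T|)%N -> density (fun x => ~~ P x) = 1 - density P.
Proof.
move=> T0; apply/eqP; rewrite eq_sym subr_eq -mulrDl -natrD eq_sym addnC.
by rewrite (cardC P) divff // pnatr_eq0 -lt0n.
Qed.

Lemma density_eq T (a : T) : density (fun x => x == a) = #|T|%:R^-1.
Proof. by rewrite /density (card1 a) mul1r. Qed.

Lemma density_forall T I (P : I -> pred T) : (0 < #|T|)%N ->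
  density (fun h : {ffun I -> T} => [forall i, P i (h i)]) =
  \prod_i density (P i).
Proof.
move=> T0; rewrite /density (eq_card (B := family P)); last first.
  by move=> h; rewrite unfold_in; apply/forallP/familyP.
rewrite card_family card_ffun prodf_div prodr_const natrX; congr (_ / _).
by rewrite -natr_prod foldrE big_map big_enum.
Qed.

Lemma density_forall_in T I (D : {pred I}) (P : I -> pred T) : (0 < #|T|)%N ->
  density (fun h : {ffun I -> T} => [forall i in D, P i (h i)]) =
  \prod_(i in D) density (P i).
Proof.
move=> T0; rewrite (density_forall (fun i x => (i \in D) ==> P i x)) //.
rewrite (bigID (mem D)) /= [X in _ * X]big1 ?mulr1.
  by apply: eq_bigr => i iD; rewrite iD.
move=> i /negbTE->; rewrite /density (eq_card (B := predT)) //.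
by rewrite divff // pnatr_eq0 -lt0n.
Qed.

(** An image has at most as many points as its source; the ratio of cardinals changes the
    normalisation. This carries bounds on pairs of factors over to their products. *)
Lemma density_image_le T1 T2 (phi : T1 -> T2) (P : pred T1) : (0 < #|T1|)%N ->
  density (fun y => [exists x in P, y == phi x]) <=
  #|T1|%:R / #|T2|%:R * density P.
Proof.
move=> T1_gt0; rewrite mulrC mulrA divfK ?pnatr_eq0 -?lt0n //.
rewrite ler_wpM2r ?invr_ge0 // ler_nat.
apply: leq_trans (leq_image_card phi P); apply/subset_leq_card.
apply/fintype.subsetP => y /existsP[x /andP[Px /eqP->]].
by apply/fintype.imageP; exists x.
Qed.

(** Disjoint blocks are independent: splitting a word into its blocks and its letters outside
    [codom e] is injective, which leaves at most [#|W|] choices per block. *)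
Lemma density_blocks T I J L (e : J * L -> I) (W : pred {ffun L -> T}) :
    (0 < #|T|)%N -> injective e ->
  density (fun h : {ffun I -> T} => [forall j, W [ffun l => h (e (j, l))]]) <=
  density W ^+ #|J|.
Proof.
move=> T0 inje; set P := (X in density X).
pose S := {i : I | i \notin codom e}.
pose phi (h : {ffun I -> T}) : {ffun J -> {ffun L -> T}} * {ffun S -> T} :=
  ([ffun j => [ffun l => h (e (j, l))]], [ffun i => h (val i)]).
have injphi : injective phi.
  move=> h1 h2 [/ffunP E1 /ffunP E2]; apply/ffunP => i.
  have [/codomP[[j l] ->]|iS] := boolP (i \in codom e).
    by move: (E1 j); rewrite !ffunE => /ffunP/(_ l); rewrite !ffunE.
  by move: (E2 (Sub i iS)); rewrite !ffunE.
have cardI : #|I| = (#|J| * #|L| + #|{: S}|)%N.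
  by rewrite card_sig -card_prod -(card_codom inje) cardC.
have cardP : (#|P| <= #|W| ^ #|J| * #|T| ^ #|{: S}|)%N.
  rewrite -(fintype.card_image injphi) -card_ffun -(card_ffun_on J).
  rewrite -fintype.cardX.
  apply/subset_leq_card.
  apply/fintype.subsetP => _ /fintype.imageP[h /forallP hP ->].
  rewrite !inE /= andbT.
  by apply/ffun_onP => j; rewrite ffunE; apply: hP.
have T1 : 0 < #|T|%:R :> R by rewrite ltr0n.
rewrite /density expr_div_n !card_ffun cardI !natrX exprD mulnC exprM.
rewrite ler_pdivrMr ?mulr_gt0 ?exprn_gt0 //.
rewrite mulrA divfK ?gt_eqF ?exprn_gt0 //.
by rewrite -!natrX -natrM ler_nat.
Qed.

End Density.

(** * Arithmetic and supports of max-min polynomials *)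

Section MaxMinPoly.
Variables (b : nat) (hb : (2 <= b)%N).
Notation B := (maxmin hb).
Implicit Types (x y : B) (f g h : {poly B}).

Lemma card_maxmin : #|{: B}| = b.
Proof. exact: card_ord. Qed.

Lemma maxmin_le1 x : (nat_of_ord x <= b.-1)%N.
Proof. by rewrite -ltnS prednK ?ltn_ord // ltnW. Qed.

Lemma maxmin_eq0 x : (x == 0) = (nat_of_ord x == 0)%N.
Proof. by rewrite -val_eqE. Qed.

Lemma maxmin_eq1 x : (x == 1) = (nat_of_ord x == b.-1)%N.
Proof. by rewrite -val_eqE. Qed.

Lemma maxmin_val_add x y : nat_of_ord (x + y) = maxn (nat_of_ord x) (nat_of_ord y).
Proof. by rewrite /GRing.add /= /maxmin_add /Order.max ltEord /maxn; case: ifP. Qed.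

Lemma maxmin_val_mul x y : nat_of_ord (x * y) = minn (nat_of_ord x) (nat_of_ord y).
Proof. by rewrite /GRing.mul /= /maxmin_mul /Order.min ltEord /minn; case: ifP. Qed.

Lemma maxmin_add_eq0 x y : (x + y == 0) = (x == 0) && (y == 0).
Proof. by rewrite !maxmin_eq0 maxmin_val_add; lia. Qed.

Lemma maxmin_mul_eq0 x y : (x * y == 0) = (x == 0) || (y == 0).
Proof. by rewrite !maxmin_eq0 maxmin_val_mul; lia. Qed.

Lemma maxmin_add1 x : 1 + x = 1.
Proof.
apply/eqP; rewrite maxmin_eq1 maxmin_val_add /=.
by have := maxmin_le1 x; lia.
Qed.

Lemma maxmin_mul_eq1 x y : (x * y == 1) = (x == 1) && (y == 1).
Proof.
rewrite !maxmin_eq1 maxmin_val_mul.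
by have := maxmin_le1 x; have := maxmin_le1 y; lia.
Qed.

(** Nothing cancels under max and min, so the support of a product is the sumset of the two
    supports. *)
Lemma maxmin_coefM_neq0 f g j :
  reflect (exists2 i, (i <= j)%N & f`_i != 0 /\ g`_(j - i) != 0) ((f * g)`_j != 0).
Proof.
have sum0 (s : seq 'I_j.+1) (F : 'I_j.+1 -> B) :
  (\sum_(i <- s) F i == 0) = all (fun i => F i == 0) s.
  by elim: s => [|i s IH]; rewrite ?big_nil ?eqxx // big_cons maxmin_add_eq0 IH.
rewrite coefM sum0 -has_predC; apply: (iffP hasP) => [[i _] /=|[i ij [fi gi]]].
  rewrite maxmin_mul_eq0 negb_or => /andP[fi gi].
  by exists i => //; rewrite -ltnS.
exists (Ordinal (ij : i < j.+1)%N); first exact: mem_index_enum.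
by rewrite /= maxmin_mul_eq0 negb_or fi gi.
Qed.

Lemma maxmin_coefM_eq1 f g i j : f`_i = 1 -> g`_j = 1 -> (f * g)`_(i + j) = 1.
Proof.
move=> fi gj; have ij : (i < (i + j).+1)%N by rewrite ltnS leq_addr.
by rewrite coefM (bigD1 (Ordinal ij)) //= addKn fi gj mulr1 maxmin_add1.
Qed.

Lemma maxmin_coefCM_neq1 f g j : (size f <= 1)%N -> f != 1 -> (f * g)`_j != 1.
Proof.
move=> /size1_polyC fC; rewrite fC coefCM maxmin_mul_eq1 => /negP f1.
by apply/negP => /andP[/eqP f01 _]; apply: f1; rewrite f01.
Qed.

Lemma size_mul_maxmin f g : f != 0 -> g != 0 -> size (f * g) = (size f + size g).-1.
Proof.
move=> f0 g0; apply: size_proper_mul.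
by rewrite maxmin_mul_eq0 !lead_coef_eq0 negb_or f0 g0.
Qed.

End MaxMinPoly.

(** * Windows: translates of a support through a central coefficient *)

Section Windows.
Variables (R : realFieldType) (b : nat) (hb : (2 <= b)%N).
Notation B := (maxmin hb).
Local Notation density := (@density R _).

Lemma card_maxmin_gt0 : (0 < #|{: B}|)%N.
Proof. by rewrite card_maxmin ltnW. Qed.
Local Hint Resolve card_maxmin_gt0 : core.

Lemma density_maxmin_eq (x : B) : density (fun y => y == x) = b%:R^-1.
Proof. by rewrite density_eq card_maxmin. Qed.

Lemma density_maxmin_neq (x : B) : density (fun y => y != x) = 1 - b%:R^-1.
Proof. by rewrite densityC // density_maxmin_eq. Qed.

Definition window k (F : {set 'I_k.+1}) (w : {ffun 'I_k.*2.+1 -> B}) : bool :=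
  (w (inord k) == 0) ||
  [exists i in F, [forall i' in F, w (inord (k - i + i')) != 0]].

(** A nonzero central coefficient uses some nonzero coefficient of [g]; multiplied by every term of
    [f], that one puts a whole translate of the support of [f] into the product. *)
Lemma window_coefM (f g : {poly B}) k a : size f = k.+1 ->
  window (finset (fun i : 'I_k.+1 => f`_i != 0))
    [ffun l : 'I_k.*2.+1 => (f * g)`_(a + l)].
Proof.
move=> sf; rewrite /window !ffunE inordK ?ltnS -?addnn ?leq_addr //.
have [//|/maxmin_coefM_neq0[i ij [fi gi]]] := eqVneq; apply/existsP.
have ik : (i < k.+1)%N by rewrite -sf ltnNge; apply: contra_neqN fi => ?; rewrite nth_default.
exists (Ordinal ik); rewrite inE fi /=; apply/forallP => i'; apply/implyP; rewrite inE => fi'.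
rewrite ffunE inordK; last by have := ltn_ord i'; lia.
apply/maxmin_coefM_neq0; exists i'; first by lia.
by split=> //; rewrite (_ : (_ - _ = a + k - i)%N) //; lia.
Qed.

(** Union bound over a zero centre and over the point of [F] placed at the centre; it is effective
    for large [F]. *)
Lemma density_window_le k (F : {set 'I_k.+1}) :
  density (window F) <= b%:R^-1 + (1 - b%:R^-1) ^+ #|F| *+ #|F|.
Proof.
apply: le_trans (densityU_le _ _ _) _; apply: lerD.
  rewrite (le_trans (le_density (Q := fun w : {ffun 'I_k.*2.+1 -> B} =>
    [forall l in pred1 (inord k), (w l == 0)]) _ _)) //.
    by move=> w wk; apply/forallP => l; apply/implyP => /eqP->.
  rewrite (density_forall_in R (pred1 (inord k)) (fun _ (y : B) => y == 0)) //.
  by rewrite big_pred1_eq density_maxmin_eq.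
apply: le_trans (density_exists_le _ _ _) _.
rewrite -sumr_const; apply: ler_sum => i _.
pose e (i' : 'I_k.+1) : 'I_k.*2.+1 := inord (k - i + i').
have ek (i' : 'I_k.+1) : e i' = (k - i + i')%N :> nat.
  by rewrite inordK //; have := ltn_ord i'; lia.
have inje : injective e.
  by move=> x y /(congr1 val); rewrite /= !ek => /addnI/val_inj.
rewrite -(card_imset _ inje) -prodr_const.
under [leRHS]eq_bigr => l _ do rewrite -(density_maxmin_neq 0).
rewrite -(density_forall_in R (e @: F) (fun _ (y : B) => y != 0)) //.
apply: le_density => w /forallP wF; apply/forallP => l.
by apply/implyP => /imsetP[i' i'F ->]; have := wF i'; rewrite i'F.
Qed.

(** A pattern on at most [#|F|.+1] cells defeats the window: the centre is [1], and each translate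
    of [F] loses one cell, the image of its last point, or of its first point when the last one sits
    at the centre. *)
Lemma density_window_ends_le k (F : {set 'I_k.+2}) :
  ord0 \in F -> ord_max \in F ->
  density (window F) <= 1 - b%:R^-1 ^+ #|F|.+1.
Proof.
move=> F0 Fk; rewrite lerBrDr -lerBrDl -densityC; last first.
  by rewrite card_ffun expn_gt0 card_maxmin_gt0.
pose c : 'I_k.+1.*2.+1 := inord k.+1.
(* The translate with [i] at the centre starts at [k.+1 - i], which is [0] for [i = ord_max], and
   ends at [k.+1.*2 - i]. *)
pose e (i : 'I_k.+2) : 'I_k.+1.*2.+1 :=
  inord (if i == ord_max then 0 else k.+1.*2 - i)%N.
pose v l : B := if l == c then 1 else 0.
pose D := (c |: e @: F)%SET.
have cardD : (#|D| <= #|F|.+1)%N.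
  rewrite /D cardsU1; apply: (@leq_add _ _ 1); first by case: (_ \notin _).
  exact: leq_imset_card.
have vc : c = k.+1 :> nat by rewrite inordK // ltnS -addnn leq_addr.
have ve i : e i = (if i == ord_max then 0 else k.+1.*2 - i)%N :> nat.
  by rewrite inordK //; case: ifP => _; rewrite ltnS ?leq_subr.
have ec i : e i == c = false.
  apply/negbTE; rewrite -val_eqE /= vc ve.
  case: (eqVneq i ord_max) => //; rewrite -val_eqE /=.
  have := ltn_ord i. lia.
apply: (@le_trans _ _ (density (fun w : {ffun 'I_k.+1.*2.+1 -> B} =>
    [forall l in D, w l == v l]))).
  rewrite (density_forall_in R D (fun l (y : B) => y == v l)) //.
  under eq_bigr => l _ do rewrite density_maxmin_eq.
  by rewrite prodr_const ler_wiXn2l ?invr_ge0 // invf_le1 ?ler1n ?ltr0n ltnW.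
apply: le_density => w /forallP wD; have {}wD l : l \in D -> w l = v l.
  by move=> lD; have := wD l; rewrite lD => /eqP.
rewrite /window negb_or -/c wD ?setU11 // {1}/v eqxx oner_neq0 /=.
apply/existsPn => i; rewrite negb_and; case iF: (i \in F) => //=.
have wi : w (e i) = 0 by rewrite wD ?/v ?ec // setU1r // imset_f.
apply/forallPn; exists (if i == ord_max then ord0 else ord_max).
rewrite negb_imply (fun_if (fun x => x \in F)) F0 Fk if_same /= negbK -wi.
apply/eqP; congr (w _); apply/val_inj; rewrite /= ve inordK.
  case: eqVneq => [->|] /=; first by lia.
  by have := ltn_ord i; lia.
by case: eqVneq => /= _; have := ltn_ord i; lia.
Qed.

End Windows.

(** * Polynomial factors against geometric decay *)

Lemma natr_mul_expr_le (R : realFieldType) (t : R) n : 0 < t < 1 ->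
  n%:R * t ^+ n <= (t^-1 - 1)^-1.
Proof.
move=> /andP[t0 t1]; have t1' : 0 < t^-1 - 1 by rewrite subr_gt0 invf_gt1.
(* A form of the Bernoulli inequality for [t^-1]. *)
suff : n%:R * (t^-1 - 1) <= t ^- n.
  by rewrite -ler_pdivlMr // -[leRHS]mulrC -ler_pdivlMr ?exprn_gt0.
rewrite -exprVn; elim: n => [|n IHn]; first by rewrite mul0r.
have tn : 1 <= t^-1 ^+ n by rewrite exprn_ege1 // invf_ge1 // ltW.
rewrite exprS -natr1 mulrDl mul1r; nra.
Qed.

Lemma cvg_natrX_expr (R : realType) d (t : R) : 0 < t < 1 ->
  ((fun n => n%:R ^+ d * t ^+ n) @ \oo --> (0 : R))%classic.
Proof.
elim: d t => [|d IHd] t /andP[t0 t1].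
  under eq_fun => n do rewrite expr0 mul1r.
  by apply: cvg_expr; rewrite gtr0_norm.
(* One factor [s ^+ n] absorbs one factor [n]; the other is left for the induction hypothesis. *)
set s := Num.sqrt t; have st : t = s * s by rewrite -expr2 sqr_sqrtr // ltW.
have s0 : 0 < s by rewrite sqrtr_gt0.
have s1 : s < 1 by rewrite -sqrtr1 ltr_sqrt.
apply: (@squeeze_cvgr _ _ _ _ (fun=> 0) (fun n => (s^-1 - 1)^-1 * (n%:R ^+ d * s ^+ n))).
- near=> n; rewrite mulr_ge0 ?exprn_ge0 ?ler0n ?(ltW t0) //= st exprMn.
  rewrite exprS (_ : _ * _ * _ = (n%:R * s ^+ n) * (n%:R ^+ d * s ^+ n)); last by ring.
  by rewrite ler_wpM2r ?mulr_ge0 ?exprn_ge0 ?ler0n ?(ltW s0) // natr_mul_expr_le ?s0.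
- exact: cvg_cst.
- have /(cvgMl_tmp (a := (s^-1 - 1)^-1)) :
    ((fun n => n%:R ^+ d * s ^+ n) @ \oo --> (0 : R))%classic.
    by apply: IHd; rewrite s0.
  by rewrite mulr0.
Unshelve. all: by end_near.
Qed.

(** * A uniform window bound below 1 *)

Section GapProbability.
Variables (R : realType) (b : nat) (hb : (2 <= b)%N).
Notation B := (maxmin hb).

(* The union bound of [density_window_le] is below 3/4 once the support F is
   large; for the finitely many remaining sizes of F, [density_window_ends_le]
   gives a bound that depends on #|F| only. *)
Lemma density_window_lt1 : exists2 rho : R, 0 < rho < 1 &
  forall k (F : {set 'I_k.+2}), ord0 \in F -> ord_max \in F ->
    density R (@window b hb _ F) <= rho.
Proof.
set p : R := 1 - b%:R^-1.
have b0 : 0 < b%:R^-1 :> R by rewrite invr_gt0 ltr0n ltnW.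
have b1 : b%:R^-1 <= 2^-1 :> R by rewrite lef_pV2 ?posrE ?ltr0n ?ler_nat // ltnW.
have /cvgrPdist_lt/(_ 4^-1)[|S _ hS] :
    ((fun n => n%:R ^+ 1 * p ^+ n) @ \oo --> (0 : R))%classic.
  by apply: cvg_natrX_expr; rewrite /p; lra.
  by rewrite invr_gt0.
have bS : 0 < b%:R^-1 ^+ S.+1 :> R by rewrite exprn_gt0.
exists (Num.max (3 / 4) (1 - b%:R^-1 ^+ S.+1)).
  by rewrite lt_max gt_max; apply/andP; split; [apply/orP; left|apply/andP; split]; lra.
move=> k F F0 Fk; rewrite le_max; apply/orP; have [SF|FS] := leqP S #|F|.
  left; apply: le_trans (density_window_le R hb F) _.
  have := hS _ SF; rewrite /= sub0r normrN expr1 mulr_natl.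
  by move=> /(le_lt_trans (ler_norm _)); rewrite -/p; lra.
right; apply: le_trans (density_window_ends_le R hb F0 Fk) _.
by rewrite lerD2l lerN2 ler_wiXn2l ?(ltW b0) ?leqW //; lra.
Qed.

End GapProbability.

(** * Coefficient words and the exceptional classes of products *)

Section Words.
Variables (b : nat) (hb : (2 <= b)%N).
Notation B := (maxmin hb).
Notation word N := {ffun 'I_N.+1 -> B}.

Definition poly_of_word N (w : word N) : {poly B} := \poly_(i < N.+1) w (inord i).

Definition word_of_poly N (h : {poly B}) : word N := [ffun i : 'I_N.+1 => h`_i].

Lemma word_of_polyK N (h : {poly B}) :
  (size h <= N.+1)%N -> poly_of_word (word_of_poly N h) = h.
Proof.
move=> sh; apply/polyP => i; rewrite coef_poly ffunE.
by case: ltnP => [iN|Ni]; [rewrite inordK|rewrite nth_default // (leq_trans sh)].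
Qed.

Lemma poly_of_wordK N : cancel (@poly_of_word N) (@word_of_poly N).
Proof. by move=> w; apply/ffunP => i; rewrite ffunE coef_poly ltn_ord inord_val. Qed.

Lemma size_poly_of_word N (w : word N) :
  (size (poly_of_word w) == N.+1) = (w ord_max != 0).
Proof.
have wN : w (inord N) = w ord_max by congr (w _); apply/val_inj; rewrite /= inordK.
apply/eqP/idP => [sw|w0]; last by apply: size_poly_eq; rewrite /= wN.
have : lead_coef (poly_of_word w) != 0 by rewrite lead_coef_eq0 -size_poly_eq0 sw.
by rewrite lead_coefE sw coef_poly ltnSn wN.
Qed.

(* A pair of coefficient words is encoded as one word on the disjoint union of
   the index sets, so that [density_blocks] applies to pairs of coefficients. *)
Definition word_mul k m N (q : {ffun 'I_k.+1 + 'I_m.+1 -> B}) : word N :=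
  word_of_poly N (poly_of_word [ffun i => q (inl i)] * poly_of_word [ffun i => q (inr i)]).

Definition top_free N (w : word N) : bool := [forall i, w i != 1].

(** The factor enters only through its degree [k.+1] and its support [F], which leaves few cases for
    a union bound. *)
Definition has_short_factor K M N (w : word N) : bool :=
  [exists k : 'I_(2 * K),
    [exists F in [pred F : {set 'I_k.+2} | (ord0 \in F) && (ord_max \in F)],
      [forall t : 'I_M, window F [ffun l : 'I_k.+1.*2.+1 =>
        w (inord (t * k.+1.*2.+1 + l))]]]].

Definition top_block K N (w : word N) : bool :=
  [forall t : 'I_K, w (inord (K + t)) == 1].

(** Each pair of letters at [t] and [K + j - t] contributes to the coefficient [K + j] of the
    product, which can differ from [1] only if no such pair is [(1, 1)]. Distinct [t] use distinct
    letters. *)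
Definition top_avoiding K k m (j : 'I_K) (q : {ffun 'I_k.+1 + 'I_m.+1 -> B}) : bool :=
  [forall t : 'I_K,
    ~~ ((q (inl (inord t)) == 1) && (q (inr (inord (K + j - t))) == 1))].

Definition has_long_factors K N (w : word N) : bool :=
  [exists k in [pred k : 'I_N.+1 | 2 * K <= k <= N - 2 * K]%N,
    [exists j : 'I_K, [exists q in @top_avoiding K k (N - k) j, w == word_mul N q]]].

Lemma short_factor_mul K M N (w : word N) (f g : {poly B}) :
  (M * (4 * K).+1 <= N.+1)%N -> poly_of_word w = f * g ->
  (1 < size f <= (2 * K).+1)%N -> f`_0 != 0 -> has_short_factor K M w.
Proof.
move=> MN wfg /andP[]; case sf: (size f) => [//|[//|k]] _ kK f0.
have k2K : (k < 2 * K)%N by lia.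
apply/existsP; exists (Ordinal k2K); apply/existsP.
exists (finset (fun i : 'I_k.+2 => f`_i != 0)); apply/andP; split.
  by rewrite !inE f0 /= -[k.+1]/(k.+2.-1) -sf -lead_coefE lead_coef_eq0 -size_poly_eq0 sf.
apply/forallP => t /=; have := window_coefM g (t * k.+1.*2.+1) sf.
congr window; apply/ffunP => l; rewrite !ffunE -wfg coef_poly ifT //.
have := ltn_ord t; have := ltn_ord l; nia.
Qed.

(** The sizes of the factors decide: a constant factor, a factor of degree at most [2 * K], or two
    longer ones. In the last case, if the block is not full, a coefficient [K + j] other than [1]
    supplies the [j] of [top_avoiding]. *)
Lemma nonprime_word_cases K M N (w : word N) :
    (M * (4 * K).+1 <= N.+1)%N -> (2 * K <= N.+1)%N ->
    w ord0 != 0 -> w ord_max != 0 -> ~ prime_maxmin (poly_of_word w) ->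
  [|| top_free w, has_short_factor K M w, top_block K w | has_long_factors K w].
Proof.
move=> MN KN w0; rewrite -size_poly_of_word => /eqP sw np.
have [f [g [wfg f1 g1]]] : exists f g : {poly B}, [/\ poly_of_word w = f * g, f != 1 & g != 1].
  apply: contra_notP np => nfg f g wfg; apply: contra_notP nfg => fg1.
  exists f, g; split=> //; apply/eqP => E; apply: fg1; [by left|by right].
have coefw (i : 'I_N.+1) : w i = (f * g)`_i.
  by rewrite -wfg coef_poly ltn_ord inord_val.
have fg0 : (f * g)`_0 != 0 by rewrite -(coefw ord0).
have /andP[f0 g0] : (f`_0 != 0) && (g`_0 != 0).
  by move: fg0; rewrite coef0M maxmin_mul_eq0 negb_or.
have fn0 : f != 0 by apply: contraNneq f0 => ->; rewrite coef0.
have gn0 : g != 0 by apply: contraNneq g0 => ->; rewrite coef0.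
have sfg : (size f + size g = N.+2)%N.
  by have := size_mul_maxmin fn0 gn0; rewrite -wfg sw => ->;
    rewrite prednK // addn_gt0 size_poly_gt0 fn0.
have [sf1|sf1] := leqP (size f) 1.
  by apply/or4P/Or41/forallP => i; rewrite coefw maxmin_coefCM_neq1.
have [sg1|sg1] := leqP (size g) 1.
  by apply/or4P/Or41/forallP => i; rewrite coefw mulrC maxmin_coefCM_neq1.
have [sfK|sfK] := leqP (size f) (2 * K).+1.
  by apply/or4P/Or42/(short_factor_mul MN wfg) => //; rewrite sf1.
have [sgK|sgK] := leqP (size g) (2 * K).+1.
  by apply/or4P/Or42/(short_factor_mul MN (etrans wfg (mulrC f g))) => //; rewrite sg1.
have [?|/forallPn[j wj]] := boolP (top_block K w); first exact/or4P/Or43.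
apply/or4P/Or44/existsP.
have kN : ((size f).-1 < N.+1)%N by lia.
exists (Ordinal kN); rewrite inE /=; apply/andP; split.
  by move: sfg sfK sgK; move: (size f) (size g) => s1 s2; lia.
set k := (size f).-1; have mE : (N - k = (size g).-1)%N by rewrite /k; lia.
pose q : {ffun 'I_k.+1 + 'I_(N - k).+1 -> B} :=
  [ffun s : 'I_k.+1 + 'I_(N - k).+1 => match s with inl i => f`_i | inr i => g`_i end].
apply/existsP; exists j; apply/existsP; exists q; apply/andP; split; last first.
  rewrite /word_mul (_ : [ffun i => _] = word_of_poly k f); last first.
    by apply/ffunP => i; rewrite !ffunE.
  rewrite (_ : [ffun i => _] = word_of_poly (N - k) g); last first.
    by apply/ffunP => i; rewrite !ffunE.
  rewrite !word_of_polyK ?mE ?leqSpred //.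
  by rewrite -wfg poly_of_wordK.
apply/forallP => t; apply: contraNN wj.
have tK := ltn_ord t; have jK := ltn_ord j.
rewrite !ffunE !inordK ?mE; [|lia|lia].
move=> /andP[/eqP ft /eqP gt]; rewrite coefw inordK; last by lia.
have := maxmin_coefM_eq1 ft gt; rewrite subnKC; last by lia.
by move=> ->.
Qed.

(** A zero constant term lets the indeterminate be split off; the cofactor has degree [N - 1 > 0],
    so it is not [1]. *)
Lemma poly_of_word_prime_head N (w : word N) : (1 < N)%N -> w ord_max != 0 ->
  prime_maxmin (poly_of_word w) -> w ord0 != 0.
Proof.
move=> N1; rewrite -size_poly_of_word => /eqP sw pw; apply/negP => /eqP w0.
pose g : {poly B} := \poly_(i < N) w (inord i.+1).
have wXg : poly_of_word w = g * 'X.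
  apply/polyP => -[|i]; rewrite coefMX !coef_poly //=.
  by rewrite -w0; congr (w _); apply/val_inj; rewrite /= inordK.
have sw' : (N.+1 <= size g + 1)%N.
  rewrite -sw wXg; apply: leq_trans (size_polyMleq _ _) _.
  by rewrite size_polyX addn2 addn1.
have [g1|X1] := pw _ _ wXg.
  by move: sw'; rewrite g1 size_poly1; lia.
by have := size_polyX B; rewrite X1 size_poly1.
Qed.

End Words.

(** * Densities of the exceptional classes *)

Section WordDensities.
Variables (R : realFieldType) (b : nat) (hb : (2 <= b)%N).
Notation B := (maxmin hb).
Notation word N := {ffun 'I_N.+1 -> B}.
Local Notation density := (@density R _).
Local Notation p := (1 - b%:R^-1 : R).
Local Hint Resolve card_maxmin_gt0 : core.

Lemma invb_ge0 : 0 <= b%:R^-1 :> R. Proof. by rewrite invr_ge0. Qed.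

Lemma density_ends_neq0 N : (0 < N)%N ->
  density (fun w : word N => (w ord0 != 0) && (w ord_max != 0)) = p ^+ 2.
Proof.
move=> N0; pose D : {set 'I_N.+1} := (ord0 |: finset (pred1 ord_max))%SET.
have <- : #|D| = 2%N.
  by rewrite cardsU1 !inE -val_eqE /= cardsE card1 eq_sym -lt0n N0.
rewrite -prodr_const.
under [RHS]eq_bigr => i _ do rewrite -(density_maxmin_neq R (0 : B)).
rewrite -(density_forall_in R D (fun _ (y : B) => y != 0)) //.
congr (_%:R / _); apply: eq_card => w; rewrite !unfold_in.
apply/andP/forallP => [[w0 wN] i|wD].
  by apply/implyP; rewrite !inE => /orP[] /eqP->.
by split; [have := wD ord0|have := wD ord_max]; rewrite !inE eqxx ?orbT.
Qed.

Lemma density_top_free N : density (@top_free b hb N) = p ^+ N.+1.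
Proof.
rewrite /top_free (density_forall R (fun _ (y : B) => y != 1)) //.
under eq_bigr do rewrite density_maxmin_neq.
by rewrite prodr_const card_ord.
Qed.

Lemma density_top_block_le K N : (2 * K <= N.+1)%N ->
  density (@top_block b hb K N) <= b%:R^-1 ^+ K.
Proof.
move=> KN; pose e (t : 'I_K) : 'I_N.+1 := inord (K + t).
have inje : injective e.
  move=> s t /(congr1 val); rewrite /= !inordK; first by move/addnI/val_inj.
    by have := ltn_ord t; lia.
  by have := ltn_ord s; lia.
rewrite -[K in _ ^+ K]card_ord -(card_imset _ inje) -prodr_const.
under [leRHS]eq_bigr => i _ do rewrite -(density_maxmin_eq R (1 : B)).
rewrite -(density_forall_in R (e @: 'I_K) (fun _ (y : B) => y == 1)) //.
apply: le_density => w /forallP wt; apply/forallP => i.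
by apply/implyP => /imsetP[t _ ->]; apply: wt.
Qed.

(** Union bound over [2 * K] degrees and at most [2 ^ (2 * K).+1] supports, as [k.+2 <= (2 * K).+1];
    for a fixed support the [M] windows are disjoint, hence independent. *)
Lemma density_short_factor_le K M N (rho : R) :
    (M * (4 * K).+1 <= N.+1)%N ->
    (forall k (F : {set 'I_k.+2}), ord0 \in F -> ord_max \in F ->
      density (@window b hb _ F) <= rho) ->
  density (@has_short_factor b hb K M N) <= (2 ^ (2 * K).+1 * (2 * K))%:R * rho ^+ M.
Proof.
move=> MN hrho.
have rho0 : 0 <= rho.
  by apply: le_trans (hrho 0%N (finset predT) _ _); rewrite ?density_ge0 ?inE.
apply: le_trans (density_exists_le _ predT _) _.
rewrite natrM mulrAC mulr_natr -[X in _ *+ X](card_ord (2 * K)) -sumr_const.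
apply: ler_sum => k _; apply: le_trans (density_exists_le _ _ _) _.
apply: (@le_trans _ _ (\sum_(F : {set 'I_k.+2}) rho ^+ M)); last first.
  have -> : \sum_(F : {set 'I_k.+2}) rho ^+ M = rho ^+ M *+ 2 ^ k.+2.
    rewrite -[X in (2 ^ X)%N]card_ord -cardsT -card_powerset -sumr_const.
    by apply: eq_bigl => F; rewrite powersetE finset.subsetT.
  rewrite -mulr_natl ler_wpM2r ?exprn_ge0 // ler_nat leq_exp2l //.
  exact: ltn_ord.
rewrite big_mkcond; apply: ler_sum => F _; case: ifP => [/andP[F0 Fk]|_]; last first.
  by rewrite exprn_ge0.
apply: (@le_trans _ _ (density (@window b hb _ F) ^+ M)); last first.
  by rewrite lerXn2r ?nnegrE ?density_ge0 // hrho.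
pose e (s : 'I_M * 'I_k.+1.*2.+1) : 'I_N.+1 := inord (s.1 * k.+1.*2.+1 + s.2).
have eE s : e s = (s.1 * k.+1.*2.+1 + s.2)%N :> nat.
  rewrite inordK // ltnS; have := ltn_ord k; have := ltn_ord s.1; have := ltn_ord s.2.
  nia.
rewrite -[M in _ ^+ M]card_ord.
have /density_blocks : injective e.
  move=> [s l] [t m] /(congr1 val) /=; rewrite !eE /= => E.
  have /val_inj st : s = t :> nat.
    (* Division by the window length recovers the index of the window. *)
    have := congr1 (fun x => x %/ k.+1.*2.+1)%N E.
    by rewrite /= !divnMDl // !divn_small // !addn0.
  by move: E; rewrite st => /addnI/val_inj->.
exact.
Qed.

(** The [K] pairs are disjoint blocks indexed by [bool], one letter from each factor, and a block is
    [(1, 1)] with probability [b ^ -2]. *)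
Lemma density_top_avoiding_le K k m (j : 'I_K) : (2 * K <= k)%N -> (2 * K <= m)%N ->
  density (@top_avoiding b hb K k m j) <= (1 - b%:R^-1 ^+ 2) ^+ K.
Proof.
move=> Kk Km.
pose e (s : 'I_K * bool) : 'I_k.+1 + 'I_m.+1 :=
  if s.2 then inl (inord s.1) else inr (inord (K + j - s.1)).
have inje : injective e.
  move=> [s []] [t []] //= [] /(congr1 val); rewrite /= !inordK;
    have := ltn_ord s; have := ltn_ord t; have := ltn_ord j; try lia.
  - by move=> _ _ _ /val_inj->.
  - by move=> jK sK tK E; congr (_, _); apply/val_inj => /=; lia.
pose W (w : {ffun bool -> B}) := ~~ [forall c, w c == 1].
have dW : density W = 1 - b%:R^-1 ^+ 2.
  rewrite densityC ?card_ffun ?expn_gt0 ?card_maxmin_gt0 //.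
  rewrite (density_forall R (fun _ (y : B) => y == 1)) //.
  under eq_bigr do rewrite density_maxmin_eq.
  by rewrite prodr_const card_bool.
rewrite -dW -[K in _ ^+ K]card_ord.
apply: le_trans (density_blocks R W _ inje) => //.
apply: le_density => q /forallP qt; apply/forallP => t.
apply: contra (qt t) => /forallP w1.
by have := w1 true; have := w1 false; rewrite !ffunE => -> ->.
Qed.

(** [N.+1] and [K] bound the choices of [k] and [j]; the factor [b] appears because a pair of
    factors has [N.+2] letters and its product only [N.+1]. *)
Lemma density_long_factors_le K N : (2 * K <= N.+1)%N ->
  density (@has_long_factors b hb K N) <=
  (N.+1 * K * b)%:R * (1 - b%:R^-1 ^+ 2) ^+ K.
Proof.
move=> KN; set r := _ ^+ K.
have r0 : 0 <= r.
  by rewrite exprn_ge0 // subr_ge0 exprn_ile1 ?invb_ge0 // invf_le1 ?ler1n ?ltr0n ltnW.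
apply: le_trans (density_exists_le _ _ _) _.
apply: (@le_trans _ _ (\sum_(k < N.+1) (K * b)%:R * r)); last first.
  by rewrite sumr_const card_ord -[leLHS]mulr_natl mulrA -natrM mulnA.
rewrite big_mkcond; apply: ler_sum => k _; rewrite inE.
case: ifP => [/andP[Kk kK]|_]; last by rewrite mulr_ge0.
apply: le_trans (density_exists_le _ predT _) _.
rewrite natrM -mulrA mulr_natl -[X in _ *+ X]card_ord -sumr_const.
apply: ler_sum => j _.
have kN := ltn_ord k.
apply: le_trans (density_image_le _ _ _ _) _.
  by rewrite card_ffun expn_gt0 card_maxmin_gt0.
apply: ler_pM; rewrite ?density_ge0 ?divr_ge0 //; last first.
  by apply: density_top_avoiding_le => //; lia.
rewrite !card_ffun card_sum !card_ord.
have -> : (k.+1 + (N - k).+1 = N.+2)%N by lia.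
by rewrite expnSr natrM mulrAC divff ?mul1r // pnatr_eq0 expn_eq0 -leqn0 leqNgt ltnW.
Qed.

End WordDensities.

(** * The choice of [K], of the order of a cube root *)

(** [K] is the largest number with [5 * K ^ 3 <= n]. The second clause makes [K ^ 2] windows fit
    into [n] letters, and the third keeps [n] polynomial in [K]. *)
Lemma cube_root_floor n : exists K,
  [/\ (5 * K <= n)%N, (K ^ 2 * (4 * K).+1 <= n)%N & (n < 5 * K.+1 ^ 3)%N].
Proof.
have P0 : exists K, (5 * K ^ 3 <= n)%N by exists 0%N.
have Pn K : (5 * K ^ 3 <= n)%N -> (K <= n)%N.
  by apply: leq_trans; rewrite !expnS; nia.
exists (ex_maxn P0 Pn); case: ex_maxnP => K Kn Kmax; split.
- by apply: leq_trans Kn; rewrite !expnS; nia.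
- by apply: leq_trans Kn; rewrite !expnS; nia.
- by rewrite ltnNge; apply/negP => /Kmax; rewrite ltnn.
Qed.

Lemma cube_bound_mul_le n K : (n < 5 * K.+1 ^ 3)%N -> (n * K <= 40 * K ^ 4)%N.
Proof.
case: K => [|K] nK; first by rewrite muln0.
have : (K.+2 ^ 3 <= (2 * K.+1) ^ 3)%N by rewrite leq_exp2r //; lia.
rewrite expnMn [(_ ^ 4)%N]expnSr (_ : (2 ^ 3 = 8)%N) // mulnA leq_mul2r => h.
apply/orP; right; apply: ltnW; apply: leq_trans nK _.
by rewrite -[40%N]/(5 * 8)%N -mulnA leq_mul2l.
Qed.

(** * Density of the prime words *)

Section PrimeDensity.
Variables (b : nat) (hb : (2 <= b)%N).
Notation B := (maxmin hb).
Notation word N := {ffun 'I_N.+1 -> B}.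

Definition prime_word N (w : word N) : bool :=
  `[< @prime_maxmin_of_size b hb N.+1 (poly_of_word w) >].

Lemma prime_maxmin_count_words N :
  prime_maxmin_count hb N.+1 = #|@prime_word N|.
Proof.
rewrite /prime_maxmin_count.
have -> : fset_set (@prime_maxmin_of_size b hb N.+1) =
    [fset poly_of_word w | w in [pred w : word N | prime_word w]]%fset.
  apply/fsetP => h; rewrite in_fset_set; last exact: finite_prime_maxmin.
  apply/idP/imfsetP => [|[w /asboolP hw ->]]; last exact/mem_set.
  move=> /set_mem hp; have hK : poly_of_word (word_of_poly N h) = h.
    by rewrite word_of_polyK //; case: hp => ->.
  exists (word_of_poly N h) => //.
  by apply/asboolP; rewrite hK.
by rewrite card_imfset /= ?cardE //; apply: can_inj (@poly_of_wordK b hb N).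
Qed.

Lemma prime_word_ends N (w : word N) : (1 < N)%N ->
  prime_word w -> (w ord0 != 0) && (w ord_max != 0).
Proof.
move=> N1 /asboolP[/eqP sw pw].
have wN : w ord_max != 0 by rewrite -size_poly_of_word.
by rewrite wN (poly_of_word_prime_head N1 wN pw).
Qed.

Variable R : realType.
Local Notation density := (@density R _).
Local Notation p := (1 - b%:R^-1 : R).

Lemma density_prime_word_le N : (1 < N)%N -> density (@prime_word N) <= p ^+ 2.
Proof.
move=> N1; rewrite -(@density_ends_neq0 R _ hb N (ltnW N1)).
by apply: le_density => w; apply: prime_word_ends.
Qed.

Lemma density_prime_word_ge N K M (rho : R) :
    (0 < N)%N -> (M * (4 * K).+1 <= N.+1)%N -> (2 * K <= N.+1)%N ->
    (forall k (F : {set 'I_k.+2}), ord0 \in F -> ord_max \in F ->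
      density (@window b hb _ F) <= rho) ->
  p ^+ 2 - (p ^+ N.+1 + (2 ^ (2 * K).+1 * (2 * K))%:R * rho ^+ M + b%:R^-1 ^+ K
            + (N.+1 * K * b)%:R * (1 - b%:R^-1 ^+ 2) ^+ K)
    <= density (@prime_word N).
Proof.
move=> N0 MN KN hrho; rewrite lerBlDr -(@density_ends_neq0 R _ hb N N0) -!addrA.
apply: (@le_trans _ _ (density (fun w : word N => prime_word w ||
    [|| top_free w, has_short_factor K M w, top_block K w | has_long_factors K w]))).
  apply: le_density => w /andP[w0 wN].
  have [//|/asboolPn pw] := boolP (prime_word w).
  apply: nonprime_word_cases => // wp; apply: pw; split=> //.
  by apply/eqP; rewrite size_poly_of_word.
apply: le_trans (densityU_le _ _ _) _; apply: lerD => //.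
apply: le_trans (densityU_le _ _ _) _; apply: lerD; first by rewrite density_top_free.
apply: le_trans (densityU_le _ _ _) _; apply: lerD; first exact: density_short_factor_le.
apply: le_trans (densityU_le _ _ _) _; apply: lerD; first exact: density_top_block_le.
exact: density_long_factors_le.
Qed.

Local Open Scope classical_set_scope.
Local Open Scope ring_scope.

Lemma density_prime_word_cvg (e : R) : 0 < e -> exists N0, forall N, (N0 <= N)%N ->
  p ^+ 2 - e <= density (@prime_word N) <= p ^+ 2.
Proof.
move=> e0; have [rho /andP[rho0 rho1] hrho] := density_window_lt1 R hb.
have bgt0 : 0 < b%:R^-1 :> R by rewrite invr_gt0 ltr0n ltnW.
have ble : b%:R^-1 <= 2^-1 :> R by rewrite lef_pV2 ?posrE ?ltr0n ?ler_nat // ltnW.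
have tau01 : 0 < (1 - b%:R^-1 ^+ 2 : R) < 1 by rewrite expr2; apply/andP; split; nra.
have e4 : 0 < e / 4 by rewrite divr_gt0.
have lim d (t c a : R) : 0 < t < 1 -> 0 < c -> 0 < a ->
    \forall K \near \oo, c * (K%:R ^+ d * t ^+ K) < a.
  move=> t01 c0 a0; have /cvgrPdist_lt/(_ (a / c)) := cvg_natrX_expr d t01.
  case=> [|K0 _ hK0]; first by rewrite divr_gt0.
  exists K0 => // K /hK0; rewrite /= sub0r normrN => /(le_lt_trans (ler_norm _)).
  by rewrite ltr_pdivlMr // mulrC.
(* The last condition tames the short-factor term, taken with [M = K ^ 2]: [4 ^ K * rho ^ (K ^ 2) =
   (4 * rho ^ K) ^ K <= 2 ^ -K]. *)
have : \forall K \near \oo, [/\ p ^+ K < e / 4,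
    4 * (K%:R * 2^-1 ^+ K) < e / 4, b%:R^-1 ^+ K < e / 4,
    (40 * b%:R) * (K%:R ^+ 4 * (1 - b%:R^-1 ^+ 2) ^+ K) < e / 4 & 4 * rho ^+ K <= 2^-1].
  near=> K; split.
  - have : 1 * (K%:R ^+ 0 * p ^+ K) < e / 4 by near: K; apply: lim => //; lra.
    by rewrite !mul1r.
  - rewrite -[K%:R]expr1; near: K; apply: lim => //; lra.
  - have : 1 * (K%:R ^+ 0 * b%:R^-1 ^+ K) < e / 4 by near: K; apply: lim => //; lra.
    by rewrite !mul1r.
  - near: K; apply: lim => //; rewrite mulr_gt0 // ltr0n ltnW //.
  - have : 4 * (K%:R ^+ 0 * rho ^+ K) < 2^-1 by near: K; apply: lim => //; lra.
    by rewrite mul1r => /ltW.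
(* This threshold forces [K0 <= K], since [5 * K0 ^ 3 <= N.+1 < 5 * K.+1 ^ 3]. *)
case=> K0 _ hK0; exists (maxn (5 * K0 ^ 3) 2) => N; rewrite geq_max => /andP[NK0 N2].
rewrite density_prime_word_le // andbT.
have [K [K3 MN NK]] := cube_root_floor N.+1.
have K0K : (K0 <= K)%N.
  by have := leq_ltn_trans (leqW NK0) NK; rewrite ltn_mul2l ltn_exp2r.
have [p_e two_e b_e tau_e rho_le] := hK0 K K0K.
apply: le_trans (density_prime_word_ge (ltnW N2) MN _ hrho); last first.
  by apply: leq_trans K3; rewrite leq_mul2r orbT.
rewrite lerD2l lerN2.
have p0 : 0 <= p by lra.
have p1 : p <= 1 by lra.
have pN : p ^+ N.+1 <= p ^+ K by rewrite ler_wiXn2l // (leq_trans _ K3) ?leq_pmull.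
have short : (2 ^ (2 * K).+1 * (2 * K))%:R * rho ^+ (K ^ 2) <= 4 * (K%:R * 2^-1 ^+ K) :> R.
  rewrite expnS expnM expnSr expn1 exprM.
  have : (4 * rho ^+ K) ^+ K <= 2^-1 ^+ K.
    by rewrite lerXn2r // nnegrE ?mulr_ge0 ?exprn_ge0 // ?invr_ge0 // ltW.
  rewrite exprMn !natrM natrX => h.
  have := ler_wpM2l (ler0n R (4 * K)) h.
  by rewrite natrM; lra.
have long : (N.+1 * K * b)%:R * (1 - b%:R^-1 ^+ 2) ^+ K <=
    (40 * b%:R) * (K%:R ^+ 4 * (1 - b%:R^-1 ^+ 2) ^+ K) :> R.
  rewrite mulrA ler_wpM2r ?exprn_ge0 //; first by case/andP: tau01 => /ltW.
  rewrite -natrX -!natrM ler_nat [leqRHS]mulnAC leq_mul2r.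
  by rewrite cube_bound_mul_le ?orbT.
lra.
Unshelve. all: by end_near.
Qed.

End PrimeDensity.

(** * The asymptotic count *)

Local Open Scope classical_set_scope.
Local Open Scope ring_scope.

Theorem mainTheorem3 (R : realType) (b : nat) (hb : (2 <= b)%N) :
  (fun n : nat => (prime_maxmin_count hb n)%:R
                  / ((b%:R - 1) ^+ 2 * b%:R ^+ (n - 2)) : R)
    @ \oo --> (1 : R).
Proof.
apply/cvgrPdist_le => e e0.
have b0 : b%:R != 0 :> R by rewrite pnatr_eq0 -lt0n ltnW.
have b1 : 2 <= b%:R :> R by rewrite ler_nat.
set p : R := 1 - b%:R^-1.
have p0 : 0 < p by rewrite subr_gt0 invf_lt1; lra.
(* The density is divided by [p ^+ 2] at the end, so the error is scaled beforehand. *)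
have e'0 : 0 < e * p ^+ 2 by rewrite mulr_gt0 ?exprn_gt0.
have [N0 hN0] := density_prime_word_cvg hb e'0.
exists N0.+2 => // -[//|[//|N]] N0N; rewrite /= prime_maxmin_count_words.
(* There are [b ^ N.+2] words, and [(b - 1) ^ 2 * b ^ N = p ^ 2 * b ^ N.+2]. *)
have -> : #|@prime_word b hb N.+1|%:R / ((b%:R - 1) ^+ 2 * b%:R ^+ (N.+2 - 2)) =
    density R (@prime_word b hb N.+1) / p ^+ 2.
  rewrite /density card_ffun !card_ord natrX !subSS subn0 !exprS expr0 /p.
  by field; rewrite b0 expf_neq0 // subr_eq0 gt_eqF //; lra.
have p2 : 0 < p ^+ 2 by rewrite exprn_gt0.
have /andP[lo hi] := hN0 N.+1 (leqW N0N).
rewrite ler_distlC ler_pdivlMr // ler_pdivrMr // mulrBl mulrDl mul1r lo /=.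
by rewrite (le_trans hi) // lerDl ltW.
Qed.
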